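(* Let $F$ be a field with $\operatorname{char}F\neq 2$, let $C$ be a Cayley--Dickson algebra over $F$, and let $\varphi\colon C\to C^*$, $\varphi(a)=a^*$, be a $C$-bimodule isomorphism. Then the solutions $r=\sum a_i\otimes b_i\in C\otimes C$ of the nonassociative Yang--Baxter equation $r_{12}r_{13}-r_{23}r_{12}-r_{13}r_{32}=0$ over $C$ are in one-to-one correspondence with the Rota--Baxter operators $R$ on $C$ of weight zero, via $R(x)=\sum b_i^*(x)\,a_i$.
   Context: A Cayley--Dickson algebra over $F$ is an $8$-dimensional (alternative) octonion algebra over $F$. The dual space $C^*$ carries the $C$-actions $(a\cdot g)(x)=g(xa)$ and $(g\cdot a)(x)=g(ax)$ for $g\in C^*$, $a,x\in C$; a linear isomorphism $\varphi\colon C\to C^*$, $a\mapsto a^*$, is a $C$-bimodule isomorphism if $(ab)^*=a\cdot b^*=a^*\cdot b$ for all $a,b\in C$. Such an isomorphism exists for $C$ (i.e. $C$ is self-adjoined). For $r=\sum a_i\otimes b_i$ the equation $r_{12}r_{13}-r_{23}r_{12}-r_{13}r_{32}=0$ means $\sum_{i,j}\bigl(a_ia_j\otimes b_i\otimes b_j-a_i\otimes a_jb_i\otimes b_j-a_i\otimes b_j\otimes b_ia_j\bigr)=0$ in $C\otimes C\otimes C$. A linear operator $R\colon C\to C$ is a Rota--Baxter operator of weight zero if $R(x)R(y)=R(R(x)y+xR(y))$ for all $x,y\in C$. *)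

(* Defs.v *)
From HB Require Import structures.
From mathcomp Require Import all_boot all_order all_algebra.

Set Implicit Arguments.
Unset Strict Implicit.
Unset Printing Implicit Defensive.

Import GRing.Theory VectorInternalTheory.
Local Open Scope ring_scope.

(* The tensor product of two finite-dimensional spaces is modelled by the     *)
(* coordinate matrices with respect to the canonical bases of V and W. This   *)
(* is justified by [tensor_span] and [tensor_universal] below: pure tensors   *)
(* span, and every bilinear map factors uniquely through (v, w) |-> v ⊗ w.    *)
Definition tensor (F : fieldType) (V W : vectType F) : Type :=
  'M[F]_(dim V, dim W).

HB.instance Definition _ (F : fieldType) (V W : vectType F) :=
  Vector.on (tensor V W).

Definition pure_tensor (F : fieldType) (V W : vectType F) (v : V) (w : W) :
  tensor V W := (v2r v)^T *m v2r w.

Notation "v ⊗ w" := (pure_tensor v w)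
  (at level 40, left associativity) : ring_scope.

Section Tensor.
Variables (F : fieldType) (V W : vectType F).

Fact pure_tensor_bilinear :
  bilinear_for (@GRing.scale F (tensor V W)) (@GRing.scale F (tensor V W))
    (@pure_tensor F V W).
Proof.
split=> [w a u v|v a u w]; rewrite /pure_tensor.
  by rewrite linearP /= linearP /= mulmxDl -scalemxAl.
by rewrite linearP /= mulmxDr -scalemxAr.
Qed.

HB.instance Definition _ :=
  bilinear_isBilinear.Build F V W (tensor V W) *:%R *:%R (@pure_tensor F V W)
    pure_tensor_bilinear.

Lemma pure_tensorPl w k u v :
  (k *: u + v) ⊗ w = k *: (u ⊗ w) + v ⊗ w :> tensor V W.
Proof. exact: pure_tensor_bilinear.1. Qed.

Lemma pure_tensorPr v k u w :
  v ⊗ (k *: u + w) = k *: (v ⊗ u) + v ⊗ w :> tensor V W.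
Proof. exact: pure_tensor_bilinear.2. Qed.

Lemma v2r_sum (U : vectType F) (u : U) :
  u = \sum_i v2r u 0 i *: r2v (delta_mx 0 i).
Proof.
apply: (can_inj v2rK); rewrite linear_sum {1}[v2r u]row_sum_delta.
by apply: eq_bigr => i _; rewrite linearZ /= r2vK.
Qed.

Lemma tensor_basis_sum (t : tensor V W) :
  t = \sum_i \sum_j
        (t i j *: r2v (delta_mx 0 i) : V) ⊗ (r2v (delta_mx 0 j) : W).
Proof.
rewrite {1}[t](matrix_sum_delta t); apply: eq_bigr => i _.
apply: eq_bigr => j _.
by rewrite linearZl_LR /= /pure_tensor !r2vK trmx_delta mul_delta_mx.
Qed.

Lemma tensor_span (t : tensor V W) :
  exists n (a : 'I_n -> V) (b : 'I_n -> W), t = \sum_(i < n) a i ⊗ b i.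
Proof.
pose I := ('I_(dim V) * 'I_(dim W))%type.
exists #|{: I}|, (fun k => let p := enum_val k in
                           t p.1 p.2 *: r2v (delta_mx 0 p.1)),
  (fun k => r2v (delta_mx 0 (enum_val k).2)).
rewrite {1}[t]tensor_basis_sum pair_big /=.
by rewrite (reindex (@enum_val _ (mem {: I}))) //=; apply: onW_bij;
  exact: enum_val_bij.
Qed.

Lemma tensor_universal (U : lmodType F) (f : {bilinear V -> W -> U}) :
  exists g : {linear tensor V W -> U}, (forall v w, g (v ⊗ w) = f v w) /\
    (forall h : {linear tensor V W -> U},
       (forall v w, h (v ⊗ w) = f v w) -> g =1 h).
Proof.
pose e i : V := r2v (delta_mx 0 i); pose d j : W := r2v (delta_mx 0 j).
pose g (t : tensor V W) := \sum_i \sum_j t i j *: f (e i) (d j).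
have g_lin : linear g.
  move=> a t u; rewrite /g scaler_sumr -big_split; apply: eq_bigr => i _ /=.
  rewrite scaler_sumr -big_split; apply: eq_bigr => j _ /=.
  by rewrite !mxE scalerDl scalerA.
pose gm := GRing.isLinear.Build F (tensor V W) U *:%R g g_lin.
pose G : {linear tensor V W -> U} := HB.pack g gm.
have GE v w : G (v ⊗ w) = f v w.
  rewrite [in RHS](v2r_sum v) linear_sumlz; apply: eq_bigr => i _.
  rewrite linearZl_LR /= [in RHS](v2r_sum w) linear_sumr scaler_sumr.
  apply: eq_bigr => j _; rewrite linearZr_LR /= scalerA; congr (_ *: _).
  by rewrite /pure_tensor mxE big_ord1 mxE.
exists G; split=> // h hE t.
rewrite [t]tensor_basis_sum !linear_sum; apply: eq_bigr => i _.
by rewrite !linear_sum; apply: eq_bigr => j _; rewrite GE hE.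
Qed.

Lemma tensor_sum_eq (U : lmodType F) (f : V -> W -> U)
    (f_bil : bilinear_for *:%R *:%R f) n m
    (a : 'I_n -> V) (b : 'I_n -> W) (c : 'I_m -> V) (d : 'I_m -> W) :
  \sum_i a i ⊗ b i = \sum_i c i ⊗ d i ->
  \sum_i f (a i) (b i) = \sum_i f (c i) (d i).
Proof.
pose fm := bilinear_isBilinear.Build F V W U *:%R *:%R f f_bil.
pose B : {bilinear V -> W -> U} := HB.pack f fm.
have [g [gE _]] := tensor_universal B.
move=> /(congr1 g); rewrite !linear_sum.
under eq_bigr => i _ do rewrite gE.
by under [in RHS]eq_bigr => i _ do rewrite gE.
Qed.

End Tensor.

Definition is_quadratic_form (F : fieldType) (V : vectType F) (N : V -> F) :
    Prop :=
  (forall (a : F) x, N (a *: x) = a ^+ 2 * N x) /\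
  bilinear_for *%R *%R (fun x y => N (x + y) - N x - N y).

Definition nondegenerate_quadratic_form (F : fieldType) (V : vectType F)
    (N : V -> F) : Prop :=
  forall x, (forall y, N (x + y) - N x - N y = 0) -> x = 0.

(* An octonion algebra is a unital composition algebra of dimension 8. No     *)
(* associativity law is assumed; alternativity is a consequence.              *)
Definition is_cayley_dickson (F : fieldType) (C : vectType F)
    (mul : {bilinear C -> C -> C}) : Prop :=
  [/\ \dim {:C} = 8%N,
      exists one : C, forall x, mul one x = x /\ mul x one = x
    & exists N : C -> F,
        [/\ is_quadratic_form N, nondegenerate_quadratic_form N
          & forall x y, N (mul x y) = N x * N y]].

Section CayleyDickson.
Variables (F : fieldType) (C : vectType F) (mul : {bilinear C -> C -> C}).
Local Notation dual := 'Hom(C, F^o).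
Local Notation "a ∘ b" := (mul a b) (at level 40, left associativity).

Definition dual_actl (a : C) (g : dual) : dual :=
  linfun (g \o applyr mul a).
Definition dual_actr (g : dual) (a : C) : dual :=
  linfun (g \o mul a).

Lemma dual_actlE a g x : dual_actl a g x = g (x ∘ a).
Proof. by rewrite lfunE. Qed.

Lemma dual_actrE g a x : dual_actr g a x = g (a ∘ x).
Proof. by rewrite lfunE. Qed.

Definition is_bimodule_iso (phi : {linear C -> dual}) : Prop :=
  bijective phi /\
  forall a b, phi (a ∘ b) = dual_actl a (phi b) /\
              phi (a ∘ b) = dual_actr (phi a) b.

(* The value of r12 r13 - r23 r12 - r13 r32 at r = \sum_i a i ⊗ b i. *)
Definition nybe_sum n (a b : 'I_n -> C) : tensor (tensor C C) C :=
  \sum_(i < n) \sum_(j < n)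
    ((a i ∘ a j) ⊗ b i ⊗ b j
     - a i ⊗ (a j ∘ b i) ⊗ b j
     - a i ⊗ b j ⊗ (b i ∘ a j)).

(* The condition does not depend on the chosen decomposition of r, by         *)
(* [nybe_sum_eq]; a decomposition always exists, by [tensor_span].            *)
Definition is_nybe_solution (r : tensor C C) : Prop :=
  forall n (a b : 'I_n -> C), r = \sum_(i < n) a i ⊗ b i -> nybe_sum a b = 0.

Definition is_rota_baxter0 (R : 'End(C)) : Prop :=
  forall x y, R x ∘ R y = R (R x ∘ y + x ∘ R y).

Lemma nybe_sum_eq n m (a b : 'I_n -> C) (c d : 'I_m -> C) :
  \sum_i a i ⊗ b i = \sum_i c i ⊗ d i -> nybe_sum a b = nybe_sum c d.
Proof.
move=> eq_ab_cd.
pose f x y z t : tensor (tensor C C) C :=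
  (x ∘ z) ⊗ y ⊗ t - x ⊗ (z ∘ y) ⊗ t - x ⊗ t ⊗ (y ∘ z).
have addE (u1 u2 u3 v1 v2 v3 : tensor (tensor C C) C) k :
    (k *: u1 + v1) - (k *: u2 + v2) - (k *: u3 + v3)
      = k *: (u1 - u2 - u3) + (v1 - v2 - v3).
  by rewrite !scalerBr !opprD (addrACA (k *: u1)) (addrACA (k *: u1 - k *: u2)).
have mulPl z k u v : (k *: u + v) ∘ z = k *: (u ∘ z) + v ∘ z.
  exact: linearPl.
have mulPr z k u v : z ∘ (k *: u + v) = k *: (z ∘ u) + z ∘ v.
  exact: linearPr.
have f_bil12 z t : bilinear_for *:%R *:%R (fun x y => f x y z t).
  split=> [y k u v|x k u v] /=; rewrite /f -addE ?(mulPl, mulPr).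
    by rewrite !(pure_tensorPl, pure_tensorPr).
  by rewrite !pure_tensorPr !pure_tensorPl.
have f_bil34 x y : bilinear_for *:%R *:%R (fun z t => f x y z t).
  split=> [t k u v|z k u v] /=; rewrite /f -addE ?(mulPl, mulPr).
    by rewrite !(pure_tensorPl, pure_tensorPr).
  by rewrite !pure_tensorPr !pure_tensorPl.
transitivity (\sum_i \sum_j f (a i) (b i) (c j) (d j)).
  by apply: eq_bigr => i _; apply: (tensor_sum_eq (f_bil34 _ _)).
rewrite exchange_big [RHS]exchange_big; apply: eq_bigr => j _.
exact: (tensor_sum_eq (f_bil12 _ _)).
Qed.

Lemma is_nybe_solutionE n (a b : 'I_n -> C) :
  is_nybe_solution (\sum_(i < n) a i ⊗ b i) <-> nybe_sum a b = 0.
Proof.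
split=> [|ab0 m c d /esym/nybe_sum_eq -> //]; exact.
Qed.

End CayleyDickson.

(* Main.v *)
(* Write <a, x> for phi(a)(x). Since C is unital, the bimodule identities      *)
(* <ab, x> = <b, xa> = <a, bx> make this nondegenerate form symmetric, hence   *)
(* r |-> R is a bijection from C ⊗ C onto End(C). Contracting the second       *)
(* factor of the Yang-Baxter expression with <-, y> and the third with <-, z>  *)
(* turns it into R(y)R(z) - R(yR(z)) - R(R(y)z), and a tensor all of whose     *)
(* contractions vanish is zero.                                                *)
Require Import Defs.
From HB Require Import structures.
From mathcomp Require Import all_boot all_order all_algebra.

Set Implicit Arguments.
Unset Strict Implicit.
Unset Printing Implicit Defensive.

Import GRing.Theory.
Local Open Scope ring_scope.

(** An element r of C ⊗ C is determined by its contractions in the second factor, and since [phi] is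
    bijective every functional on C is some [phi x]. So r is the same data as the operator x |-> (id
    ⊗ [phi x])(r), which [bimodule_iso_sym] identifies with the prescribed R ([tensor_end_sum]);
    [tensor_end_inj] and [tensor_end_surj] make this a bijection. By [contract_nybe_sum],
    contracting the Yang-Baxter expression twice leaves exactly the defect in the Rota-Baxter
    identity, so one vanishes iff the other does ([nybe_rota_baxter]). *)

Section Contraction.
Import VectorInternalTheory.
Variables (F : fieldType) (V W : vectType F).
Implicit Types (g h : 'Hom(W, F^o)) (t : tensor V W).

(** This is the map id ⊗ g, in coordinates. *)
Definition contract g t : V :=
  r2v ((t : 'M_(_, _)) *m \col_j g (r2v (delta_mx 0 j)))^T.

Fact contract_is_linear g : linear (contract g).
Proof.
move=> a t u; rewrite /contract mulmxDl -scalemxAl.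
by rewrite linearP /= linearP.
Qed.

HB.instance Definition _ g :=
  GRing.isLinear.Build F (tensor V W) V *:%R (contract g)
    (contract_is_linear g).

Lemma contract_pure g v w : contract g (v ⊗ w) = g w *: v.
Proof.
apply: (can_inj v2rK); rewrite linearZ /= r2vK /pure_tensor -mulmxA.
rewrite trmx_mul trmxK.
suff -> : v2r w *m \col_j g (r2v (delta_mx 0 j)) = (g w)%:M.
  by rewrite tr_scalar_mx mul_scalar_mx.
apply/matrixP=> i j; rewrite !ord1 !mxE eqxx mulr1n [in RHS](v2r_sum w).
by rewrite linear_sum; apply: eq_bigr => k _; rewrite mxE linearZ.
Qed.

Lemma contractDZ a g h t :
  contract (a *: g + h) t = a *: contract g t + contract h t.
Proof.
rewrite /contract -linearP /= -linearP /= scalemxAr -mulmxDr.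
do 3 congr (_ _); apply/colP=> j; rewrite !mxE.
by rewrite add_lfunE scale_lfunE.
Qed.

Definition coord_form (j : 'I_(dim W)) : 'Hom(W, F^o) :=
  linfun (fun w => v2r w 0 j : F^o).

Lemma coord_formE j w : coord_form j w = v2r w 0 j.
Proof.
have lin : linear (fun w => v2r w 0 j : F^o).
  by move=> a u v; rewrite linearP !mxE.
pose f : {linear W -> F^o} :=
  HB.pack (fun w => v2r w 0 j : F^o) (GRing.isLinear.Build _ _ _ _ _ lin).
exact: (lfunE f).
Qed.

(** Contracting with the j-th coordinate form reads off the j-th column of the matrix [t]. *)
Lemma contract_eq0 t : (forall g, contract g t = 0) -> t = 0.
Proof.
move=> t0; apply/matrixP=> i j.
have /(congr1 v2r) := t0 (coord_form j); rewrite r2vK linear0.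
move=> /rowP/(_ i); rewrite !mxE (bigD1 j) //= big1 => [|k kj].
  by rewrite mxE coord_formE r2vK mxE !eqxx mulr1 addr0.
by rewrite mxE coord_formE r2vK mxE eqxx eq_sym (negPf kj) mulr0.
Qed.

End Contraction.

Section BimoduleForm.
Variables (F : fieldType) (C : vectType F) (mul : {bilinear C -> C -> C}).
Variables (phi : {linear C -> 'Hom(C, F^o)}).
Hypothesis phi_iso : is_bimodule_iso mul phi.
Variable one : C.
Hypothesis oneP : forall x, mul one x = x /\ mul x one = x.
Local Notation "a ∘ b" := (mul a b) (at level 40, left associativity).

Lemma bimodule_isoMl a b x : phi (a ∘ b) x = phi b (x ∘ a).
Proof. by have [-> _] := phi_iso.2 a b; rewrite dual_actlE. Qed.

Lemma bimodule_isoMr a b x : phi (a ∘ b) x = phi a (b ∘ x).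
Proof. by have [_ ->] := phi_iso.2 a b; rewrite dual_actrE. Qed.

(** Writing a as 1a and b as b1, the two bimodule identities turn both sides into
    [phi one (a ∘ b)]. *)
Lemma bimodule_iso_sym a b : phi a b = phi b a.
Proof.
rewrite -[in LHS](oneP a).1 -[in RHS](oneP b).2.
by rewrite bimodule_isoMr bimodule_isoMl.
Qed.

(** Surjectivity of [phi] reduces this to [contract_eq0]. The space [V] is general so that the lemma
    applies both to C ⊗ C and to (C ⊗ C) ⊗ C. *)
Lemma bimodule_iso_contract_eq0 (V : vectType F) (t : tensor V C) :
  (forall x, contract (phi x) t = 0) -> t = 0.
Proof.
move=> t0; apply: contract_eq0 => g.
by have [psi _ phiK] := phi_iso.1; rewrite -(phiK g).
Qed.

(** [linfun] represents its argument only when that is linear; [tensor_endE] supplies the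
    linearity. *)
Definition tensor_end (r : tensor C C) : 'End(C) :=
  linfun (fun x => contract (phi x) r).

Lemma tensor_endE r x : tensor_end r x = contract (phi x) r.
Proof.
have lin : linear (fun x => contract (phi x) r).
  by move=> a u v; rewrite linearP contractDZ.
pose f : {linear C -> C} :=
  HB.pack (fun x => contract (phi x) r) (GRing.isLinear.Build _ _ _ _ _ lin).
exact: (lfunE f).
Qed.

Lemma tensor_end_sum n (a b : 'I_n -> C) x :
  tensor_end (\sum_(i < n) a i ⊗ b i) x = \sum_(i < n) phi (b i) x *: a i.
Proof.
rewrite tensor_endE linear_sum; apply: eq_bigr => i _.
by rewrite /= contract_pure bimodule_iso_sym.
Qed.

Lemma tensor_end_inj : injective tensor_end.
Proof.
move=> r s rs; apply/eqP; rewrite -subr_eq0; apply/eqP.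
apply: bimodule_iso_contract_eq0 => x.
by rewrite linearB /= -!tensor_endE rs subrr.
Qed.

Lemma tensor_end_surj (R : 'End(C)) : exists r, tensor_end r = R.
Proof.
have [psi _ phiK] := phi_iso.1.
(* With e_i the canonical basis, [psi] pulls the dual basis back to C, so this tensor yields R(x) as
   the sum of e_i^*(x) R(e_i). *)
exists (\sum_i R (VectorInternalTheory.r2v (delta_mx 0 i)) ⊗
               psi (coord_form i)).
apply/lfunP=> x; rewrite tensor_end_sum [in RHS](v2r_sum x) linear_sum.
by apply: eq_bigr => i _; rewrite phiK coord_formE linearZ.
Qed.

(** The bimodule identities move a_j off b_i and onto the argument: (a_j b_i)^*(y) = b_i^*(y a_j)
    and (b_i a_j)^*(z) = b_i^*(a_j z). Summing over j then assembles R(z), respectively R(y), inside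
    the outer R. *)
Lemma contract_nybe_sum n (a b : 'I_n -> C) y z :
  let R := tensor_end (\sum_(i < n) a i ⊗ b i) in
  contract (phi y) (contract (phi z) (nybe_sum mul a b)) =
  R y ∘ R z - R (y ∘ R z) - R (R y ∘ z).
Proof.
move=> R; have RE x : R x = \sum_(i < n) phi (b i) x *: a i.
  exact: tensor_end_sum.
have -> : R (y ∘ R z) = \sum_i \sum_j
    (phi (b j) z * phi (a j ∘ b i) y) *: a i.
  rewrite (RE (_ ∘ _)); apply: eq_bigr => i _.
  rewrite -scaler_suml RE linear_sumr linear_sum; congr (_ *: _).
  by apply: eq_bigr => j _; rewrite linearZr_LR linearZ bimodule_isoMl.
have -> : R (R y ∘ z) = \sum_i \sum_j
    (phi (b j) y * phi (b i ∘ a j) z) *: a i.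
  rewrite (RE (_ ∘ _)); apply: eq_bigr => i _.
  rewrite -scaler_suml RE linear_sumlz linear_sum; congr (_ *: _).
  by apply: eq_bigr => j _; rewrite linearZl_LR linearZ bimodule_isoMr.
have -> : R y ∘ R z = \sum_i \sum_j
    (phi (b j) z * phi (b i) y) *: (a i ∘ a j).
  rewrite !RE linear_sumlz; apply: eq_bigr => i _.
  rewrite linear_sumr; apply: eq_bigr => j _.
  by rewrite linearZl_LR linearZr_LR /= scalerA mulrC.
rewrite -!sumrB !linear_sum; apply: eq_bigr => i _.
rewrite -!sumrB !linear_sum; apply: eq_bigr => j _.
rewrite !linearB /= !contract_pure !linearZ /= !contract_pure !scalerA.
(* Contraction produces values of [phi y] and [phi z]; symmetry turns them into the coefficients
   found in the expansions of R. *)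
rewrite !(bimodule_iso_sym y) !(bimodule_iso_sym z).
by rewrite !scalerN !scalerA [phi (b j) y * _]mulrC.
Qed.

Lemma nybe_rota_baxter (r : tensor C C) :
  is_nybe_solution mul r <-> is_rota_baxter0 mul (tensor_end r).
Proof.
have [n [a [b ->]]] := tensor_span r.
apply: (iff_trans (is_nybe_solutionE mul a b)).
split=> [ab0 x y|RB].
  apply/eqP; rewrite linearD /= [X in _ == X]addrC -subr_eq0 opprD addrA.
  by rewrite -contract_nybe_sum ab0 !linear0.
(* Nondegeneracy is used once for the third tensor factor and once for the second. *)
apply: bimodule_iso_contract_eq0 => z; apply: bimodule_iso_contract_eq0 => y.
by rewrite contract_nybe_sum RB linearD addrK subrr.
Qed.

End BimoduleForm.

Theorem corollary8 (F : fieldType) (charF : 2%N \notin [pchar F])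
    (C : vectType F) (mul : {bilinear C -> C -> C})
    (CD : is_cayley_dickson mul)
    (phi : {linear C -> 'Hom(C, F^o)}) (phi_iso : is_bimodule_iso mul phi) :
  exists Rop : tensor C C -> 'End(C),
    [/\ forall n (a b : 'I_n -> C) (x : C),
          Rop (\sum_(i < n) a i ⊗ b i) x = \sum_(i < n) phi (b i) x *: a i,
        forall r, is_nybe_solution mul r -> is_rota_baxter0 mul (Rop r)
      & forall R : 'End(C), is_rota_baxter0 mul R ->
          exists! r, is_nybe_solution mul r /\ Rop r = R].
Proof.
have [_ [one oneP] _] := CD; exists (tensor_end phi); split.
- exact: (tensor_end_sum phi_iso oneP).
- by move=> r /(nybe_rota_baxter phi_iso oneP).
move=> R RB; have [r rR] := tensor_end_surj phi_iso oneP R; exists r; split.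
  by split=> //; apply/(nybe_rota_baxter phi_iso oneP); rewrite rR.
by move=> s [_ sR]; apply: (tensor_end_inj phi_iso); rewrite rR sR.
Qed.
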